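(* There exist $m,n\ge 1$, $A\in\mathbb{R}^{m\times n}$, $\mathbf{b}\in\mathbb{R}^m$, $\mathbf{c},\mathbf{d},\boldsymbol{\varphi}\in\mathbb{R}^n$ and an interval $\Lambda\subseteq\mathbb{R}$ such that for every $\lambda\in\Lambda$ the linear program $f_c(\lambda)=\min\{(\mathbf{c}+\lambda\mathbf{d})^t\mathbf{x}: A\mathbf{x}\le\mathbf{b},\ \mathbf{x}\ge0\}$ is feasible with finite optimal value, the minimum $$g_c(\lambda)=\min\{\boldsymbol{\varphi}^t\mathbf{x}\ :\ (\mathbf{c}+\lambda\mathbf{d})^t\mathbf{x}\le f_c(\lambda),\ A\mathbf{x}\le\mathbf{b},\ \mathbf{x}\ge0\}$$ is finite for every $\lambda\in\Lambda$, and the function $g_c:\Lambda\to\mathbb{R}$ is not continuous.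
   Context: Vector inequalities are componentwise. $g_c(\lambda)$ is the minimum of $\boldsymbol{\varphi}^t\mathbf{x}$ over the set of optimal solutions of the linear program defining $f_c(\lambda)$. *)

(* Defs.v *)
From HB Require Import structures.
From mathcomp Require Import all_boot all_order all_algebra.
From mathcomp Require Import all_classical all_reals all_analysis.

Set Implicit Arguments.
Unset Strict Implicit.
Unset Printing Implicit Defensive.

Import Order.TTheory GRing.Theory Num.Theory.
Import numFieldNormedType.Exports.

Local Open Scope classical_set_scope.
Local Open Scope ring_scope.

Definition cvle (R : realType) (k : nat) (u v : 'cV[R]_k) : Prop :=
  forall i, u i 0 <= v i 0.

(* u^t v as a scalar, i.e. the unique entry of a 1 x 1 matrix *)
Definition dotcv (R : realType) (k : nat) (u v : 'cV[R]_k) : R :=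
  (u^T *m v) 0 0.

Definition is_minimum (R : realType) (E : set R) (v : R) : Prop :=
  E v /\ lbound E v.

Section ParametricLP.
Variables (R : realType) (m n : nat).
Variables (A : 'M[R]_(m, n)) (b : 'cV[R]_m) (c d phi : 'cV[R]_n).

Definition lp_feasible : set 'cV[R]_n :=
  [set x | cvle (A *m x) b /\ cvle 0 x].

Definition f_values (lambda : R) : set R :=
  [set dotcv (c + lambda *: d) x | x in lp_feasible].

(* The minimum of f_values lambda whenever that minimum exists;
   inf makes it a total function of lambda. *)
Definition f_c (lambda : R) : R := inf (f_values lambda).

Definition g_feasible (lambda : R) : set 'cV[R]_n :=
  [set x | dotcv (c + lambda *: d) x <= f_c lambda /\ lp_feasible x].

Definition g_values (lambda : R) : set R :=
  [set dotcv phi x | x in g_feasible lambda].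

(* Same convention as for f_c. *)
Definition g_c (lambda : R) : R := inf (g_values lambda).

End ParametricLP.

(* Main.v *)
Require Import Defs.
From HB Require Import structures.
From mathcomp Require Import all_boot all_order all_algebra.
From mathcomp Require Import all_classical all_reals all_analysis.
From mathcomp Require Import lra.

(** Minimize lambda * x over the unit segment 0 <= x <= 1, with phi the
    identity.  The optimal value f_c is min(lambda, 0), but the optimal set
    jumps: it is {1} for lambda < 0, all of [0, 1] at lambda = 0, and {0} for
    lambda > 0.  Hence the least optimal x is 1 for lambda < 0 and 0 for
    lambda >= 0 ([unit_g_min]), so g_c jumps at 0.  With m = n = 1 and Lambda
    the whole real line, this is the required example. *)

Set Implicit Arguments.
Unset Strict Implicit.
Unset Printing Implicit Defensive.

Import Order.TTheory GRing.Theory Num.Theory.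
Import numFieldNormedType.Exports.

Local Open Scope classical_set_scope.
Local Open Scope ring_scope.

(** Connects attained minima with the total functions f_c and g_c, which are
    defined as infima. *)
Lemma is_minimum_inf (R : realType) (E : set R) (v : R) :
  is_minimum E v -> inf E = v.
Proof.
move=> [Ev lbv]; apply/eqP; rewrite eq_le; apply/andP; split.
  by apply: ge_inf => //; exists v.
by apply: lb_le_inf => //; exists v.
Qed.

Lemma dotcv1 (R : realType) (u v : 'cV[R]_1) : dotcv u v = u 0 0 * v 0 0.
Proof. by rewrite /dotcv mxE big_ord1 mxE. Qed.

Section UnitSegment.
Variable R : realType.

Let A : 'M[R]_(1, 1) := 1%:M.
Let one : 'cV[R]_1 := const_mx 1.

Lemma unit_feasible (x : 'cV[R]_1) :
  lp_feasible A one x <-> 0 <= x 0 0 <= 1.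
Proof.
rewrite /lp_feasible /= /A mul1mx; split.
  by move=> [/(_ 0) + /(_ 0)]; rewrite !mxE => -> ->.
by move=> /andP[x0 x1]; split=> i; rewrite ord1 !mxE.
Qed.

Lemma unit_objective (l : R) (x : 'cV[R]_1) :
  dotcv (0 + l *: one) x = l * x 0 0.
Proof. by rewrite dotcv1 !mxE add0r mulr1. Qed.

Lemma unit_f_min (l : R) :
  is_minimum (f_values A one 0 one l) (if l < 0 then l else 0).
Proof.
split.
  exists (const_mx (if l < 0 then 1 else 0)).
    by apply/unit_feasible; rewrite mxE; case: ifP; rewrite !lexx ler01.
  by rewrite unit_objective mxE; case: ifP; rewrite ?mulr1 ?mulr0.
move=> _ [x /unit_feasible /andP[x0 x1] <-]; rewrite unit_objective.
by case: ltP => l0; nra.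
Qed.

Lemma unit_f_c (l : R) : f_c A one 0 one l = if l < 0 then l else 0.
Proof. exact/is_minimum_inf/unit_f_min. Qed.

(** For lambda < 0 the constraint lambda * x <= lambda forces x >= 1; for
    lambda >= 0 the point x = 0 is optimal. *)
Lemma unit_g_min (l : R) :
  is_minimum (g_values A one 0 one one l) (if l < 0 then 1 else 0).
Proof.
split.
  exists (const_mx (if l < 0 then 1 else 0)); last first.
    by rewrite dotcv1 !mxE mul1r.
  split; last first.
    by apply/unit_feasible; rewrite mxE; case: ifP; rewrite !lexx ler01.
  rewrite unit_objective unit_f_c mxE.
  by case: ifP; rewrite ?mulr1 ?mulr0.
move=> _ [x [+ /unit_feasible /andP[x0 x1]] <-].
rewrite unit_objective unit_f_c dotcv1 mxE mul1r.
by case: ltP => l0 // lx; nra.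
Qed.

Lemma unit_g_c (l : R) : g_c A one 0 one one l = if l < 0 then 1 else 0.
Proof. exact/is_minimum_inf/unit_g_min. Qed.

Lemma unit_g_discontinuous : ~ continuous (g_c A one 0 one one).
Proof.
move=> /(_ 0) /cvgr_dist_lt /(_ 1 ltr01) [e /= e0 He].
(* g_c is 1 at every point left of 0, while g_c 0 = 0. *)
have : ball_ Num.norm 0 e (- (e / 2)).
  by rewrite /= sub0r opprK gtr0_norm; lra.
move=> /He; rewrite !unit_g_c ltxx oppr_lt0 divr_gt0 //.
by rewrite sub0r normrN normr1 ltxx.
Qed.

End UnitSegment.

Theorem mainTheorem4 (R : realType) :
  exists (m n : nat) (A : 'M[R]_(m, n)) (b : 'cV[R]_m)
         (c d phi : 'cV[R]_n) (Lambda : interval R),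
    [/\ (1 <= m)%N /\ (1 <= n)%N,
        (forall lambda : R, lambda \in Lambda ->
           is_minimum (f_values A b c d lambda) (f_c A b c d lambda)),
        (forall lambda : R, lambda \in Lambda ->
           is_minimum (g_values A b c d phi lambda) (g_c A b c d phi lambda)) &
        ~ {within [set` Lambda], continuous (g_c A b c d phi)}].
Proof.
exists 1%N, 1%N, 1%:M, (const_mx 1), 0, (const_mx 1), (const_mx 1), `]-oo, +oo[.
split=> //.
- by move=> l _; rewrite unit_f_c; exact: unit_f_min.
- by move=> l _; rewrite unit_g_c; exact: unit_g_min.
- rewrite set_itvE => gc; apply: (@unit_g_discontinuous R).
  exact/continuous_subspace_setT.
Qed.
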